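(* For every positive integer $n$, let $P_n$ denote the path of length $n$ (i.e. with $n$ edges). Then $\widetilde{r}_{ind}(P_n) \le 28n-27$.
   Context: The online Ramsey game for a target graph $H$ is played between Builder and Painter on an infinite set of vertices, initially with no edges. In each round Builder adds a new edge between two vertices (forming the background graph $G$), and Painter immediately colors that edge red or blue. The induced online Ramsey number $\widetilde{r}_{ind}(H)$ is the minimum number $m$ such that Builder has a strategy guaranteeing that, against any Painter strategy, after at most $m$ rounds there is a monochromatic induced copy of $H$ in $G$, i.e. a vertex set $S$ such that the subgraph of $G$ induced on $S$ is isomorphic to $H$ and all its edges have the same color ($\infty$ if no such strategy exists). *)

(* Defs.v *)
From HB Require Import structures.
From mathcomp Require Import all_boot.
From mathcomp Require Import finmap.
From mathcomp Require Import boolp.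

Set Implicit Arguments.
Unset Strict Implicit.
Unset Printing Implicit Defensive.

Record sgraph := SGraph {
  svertex :> finType;
  sedge : rel svertex;
  sedge_sym : symmetric sedge;
  sedge_irr : irreflexive sedge
}.

Definition path_rel (n : nat) : rel 'I_n.+1 :=
  fun i j => (i.+1 == j :> nat) || (j.+1 == i :> nat).

Lemma path_rel_sym n : symmetric (@path_rel n).
Proof. by move=> i j; rewrite /path_rel orbC. Qed.

Lemma path_rel_irr n : irreflexive (@path_rel n).
Proof. by move=> i; rewrite /path_rel orbb gtn_eqF. Qed.

(* The path with n edges, hence n + 1 vertices. *)
Definition path_graph (n : nat) : sgraph :=
  SGraph (@path_rel_sym n) (@path_rel_irr n).

(* The infinite vertex set is nat. A position is the chronological list of the
   edges drawn so far with their colors (true is red, false is blue); the pair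
   (u, v) stands for the unordered edge uv. *)
Definition edge : Type := nat * nat.
Definition position : Type := seq (nat * nat * bool).

Definition colored (h : position) (c : bool) : rel nat :=
  fun u v => ((u, v, c) \in h) || ((v, u, c) \in h).

Definition adj (h : position) : rel nat :=
  fun u v => colored h true u v || colored h false u v.

Definition legal_move (h : position) (e : edge) : bool :=
  (e.1 != e.2) && ~~ adj h e.1 e.2.

Definition builder_strategy : Type := position -> edge.
Definition painter_strategy : Type := position -> edge -> bool.

Definition legal_strategy (B : builder_strategy) : Prop :=
  forall h : position, legal_move h (B h).

Fixpoint play (B : builder_strategy) (P : painter_strategy) (k : nat) :
    position :=
  if k is k'.+1 then
    let h := play B P k' in rcons h (B h, P h (B h))
  else [::].

Definition induced_iso (H : sgraph) (h : position) (S : {fset nat}) : Prop :=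
  exists f : H -> S,
    bijective f /\ forall x y : H, sedge x y = adj h (val (f x)) (val (f y)).

Definition mono_induced_copy (H : sgraph) (h : position) : Prop :=
  exists (S : {fset nat}) (c : bool),
    induced_iso H h S /\
    (forall u v : nat, u \in S -> v \in S -> adj h u v -> colored h c u v).

(* The copy must be present at some moment among the first m rounds: further
   edges could destroy its being induced, so the game stops there. *)
Definition builder_wins_within (H : sgraph) (m : nat) : Prop :=
  exists B : builder_strategy, legal_strategy B /\
    forall P : painter_strategy,
      exists k : nat, k <= m /\ mono_induced_copy H (play B P k).

(* Values in nat extended with infinity, which is None. *)
Definition induced_online_ramsey (H : sgraph) : option nat :=
  match pselect (exists m, `[< builder_wins_within H m >]) with
  | left ex_m => Some (ex_minn ex_m)
  | right _ => None
  end.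

Definition le_onat (x y : option nat) : bool :=
  match x, y with
  | _, None => true
  | None, Some _ => false
  | Some m, Some n => m <= n
  end.

(* Main.v *)
Require Import Defs.
From mathcomp Require Import all_boot.
From mathcomp Require Import finmap boolp zify.

(** Builder maintains three pairwise disjoint induced monochromatic paths with
    no edges between them: [P] of color [c], [N] of the other color and a spare
    [Q] of color [c], with ends [x], [y] and [t].  The potential
    [5 (|P| + |N|) + |Q|] grows by at least the number of edges played.
    Builder first plays [t z] with [z] fresh.  In color [c] this lengthens [Q];
    in the other color, if [Q] is a single vertex, [t z] becomes the spare and
    the colors swap roles.  Otherwise [t] is an end of a [c]-path (namely [Q])
    and of a path of the other color ([t z]).  Builder then plays [x y], so that
    some [s] in [{x, y}] is an end of a path of each color, and finally [s t]:
    whatever its color, it joins two paths, and deleting at most two end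
    vertices from each of the other paths restores separation. *)

Set Implicit Arguments.
Unset Strict Implicit.
Unset Printing Implicit Defensive.

(** * Colors, adjacency and separation of vertices *)

Lemma colored_sym h c : symmetric (colored h c).
Proof. by move=> u v; rewrite /colored orbC. Qed.

Lemma adj_sym h : symmetric (adj h).
Proof. by move=> u v; rewrite /adj !(colored_sym h _ u v). Qed.

Lemma colored_adj h c u v : colored h c u v -> adj h u v.
Proof. by rewrite /adj; case: c => ->; rewrite ?orbT. Qed.

Lemma colored_rcons h a b d c u v : colored (rcons h (a, b, d)) c u v =
  [|| (d == c) && ((u == a) && (v == b) || (u == b) && (v == a))
    | colored h c u v].
Proof.
rewrite /colored !mem_rcons !inE !xpair_eqE (eq_sym d).
by case: (c == d); rewrite ?andbF ?andbT //= orbACA [(v == a) && _]andbC.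
Qed.

Lemma adj_rcons h a b d u v : adj (rcons h (a, b, d)) u v =
  ((u == a) && (v == b) || (u == b) && (v == a)) || adj h u v.
Proof.
by rewrite /adj !colored_rcons; case: d; [rewrite /= orbA|rewrite /= orbCA].
Qed.

Definition endpoints (h : position) : seq nat :=
  flatten [seq [:: e.1.1; e.1.2] | e <- h].

Lemma adj_endpoints h u v :
  adj h u v -> (u \in endpoints h) && (v \in endpoints h).
Proof.
have mem_ends a b d : (a, b, d) \in h ->
    (a \in endpoints h) && (b \in endpoints h).
  by move=> abh; apply/andP; split; apply/flatten_mapP;
     exists (a, b, d); rewrite // !inE eqxx ?orbT.
by rewrite /adj /colored => /orP[] /orP[] /mem_ends // /andP[-> ->].
Qed.

(** A position is an arbitrary list of edges; excluding loops settles the diagonal of the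
    isomorphism in [mono_path_win]. *)
Definition loopless (h : position) := all (fun e => e.1.1 != e.1.2) h.

Lemma loopless_adj h u : loopless h -> adj h u u = false.
Proof.
move=> /allP loopf; apply/negP; rewrite /adj /colored !orbb.
by case/orP=> /loopf; rewrite eqxx.
Qed.

(** With distinctness built in, separated sequences are automatically disjoint. *)
Definition apart (h : position) : rel nat :=
  fun u v => (u != v) && ~~ adj h u v.

Lemma apart_sym h : symmetric (apart h).
Proof. by move=> u v; rewrite /apart eq_sym adj_sym. Qed.

Lemma apart_rcons h a b d u v : apart (rcons h (a, b, d)) u v =
  apart h u v && ~~ ((u == a) && (v == b) || (u == b) && (v == a)).
Proof. by rewrite /apart adj_rcons negb_or andbA andbAC. Qed.

Definition separated h (s1 s2 : seq nat) := allrel (apart h) s1 s2.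
Arguments separated : simpl never.

Lemma separated_sym h s1 s2 : separated h s1 s2 = separated h s2 s1.
Proof.
by rewrite /separated allrelC; apply: eq_allrel => u v; rewrite apart_sym.
Qed.

Lemma separated_consl h x s1 s2 :
  separated h (x :: s1) s2 = all (apart h x) s2 && separated h s1 s2.
Proof. exact: allrel_consl. Qed.

Lemma separated_catr h s s1 s2 :
  separated h s (s1 ++ s2) = separated h s s1 && separated h s s2.
Proof. exact: allrel_catr. Qed.

Lemma fresh_vertex h s : exists z, all (apart h z) s.
Proof.
pose z := (\max_(i <- s ++ endpoints h) i).+1.
have big v : v \in s ++ endpoints h -> v < z.
  by move=> vs; rewrite ltnS (leq_bigmax_seq _ vs).
exists z; apply/allP => v vs; rewrite /apart gtn_eqF; last first.
  by rewrite big // mem_cat vs.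
apply/negP => /adj_endpoints /andP[zh _].
by have := big z; rewrite mem_cat zh orbT ltnn => /(_ isT).
Qed.

(** * Induced monochromatic paths *)

Definition linked h c (x : nat) (s : seq nat) :=
  if s is y :: s' then [&& x != y, colored h c x y & all (apart h x) s']
  else true.

(* The head of the sequence is the end at which the path gets extended. *)
Fixpoint mono_path h c (s : seq nat) :=
  if s is x :: s' then linked h c x s' && mono_path h c s' else true.

Lemma mono_path_behead h c s : mono_path h c s -> mono_path h c (behead s).
Proof. by case: s => //= x s /andP[]. Qed.

Lemma linked_behead h c x s : linked h c x s -> all (apart h x) (behead s).
Proof. by case: s => //= y s /and3P[]. Qed.

(** Two paths are joined head to head by moving the vertices of the first onto the second one at a
    time. Once [x] has moved, the joining edge is the next edge of the first path, so the hypotheses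
    recur. *)
Lemma mono_path_catrev h c x s1 y s2 :
    mono_path h c (x :: s1) -> mono_path h c (y :: s2) ->
    x != y -> colored h c x y -> all (apart h x) s2 -> all (apart h y) s1 ->
    separated h s1 s2 ->
  mono_path h c (catrev (x :: s1) (y :: s2)).
Proof.
elim: s1 x y s2 => [|x' s1 IH] x y s2.
  by move=> _ /= -> -> -> ->.
move=> /= /andP[/and3P[nxx' cxx' xs1] Ps1] Ps2 nxy cxy xs2 /andP[yx' ys1].
rewrite separated_consl => /andP[x's2 s12].
apply: IH => //=; rewrite ?nxy ?cxy ?xs2 //.
- by rewrite eq_sym.
- by rewrite colored_sym.
- by rewrite apart_sym yx'.
- by rewrite separated_sym separated_consl ys1 separated_sym.
Qed.

Lemma mono_path_nth h c s i j : mono_path h c s -> i < j < size s ->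
  [/\ nth 0 s i != nth 0 s j,
      adj h (nth 0 s i) (nth 0 s j) = (i.+1 == j)
    & i.+1 = j -> colored h c (nth 0 s i) (nth 0 s j)].
Proof.
elim: s i j => [|x s IH] i j; first by rewrite andbF.
case: i j => [|i] [|j] //=.
  case: s {IH} => [|y s] //= /andP[/and3P[nxy cxy xs] _] js.
  case: j js => [|j] js /=; first by split=> //; rewrite (colored_adj cxy).
  have /andP[-> /negbTE->] := allP xs _ (mem_nth 0 (js : j < size s)).
  by [].
by move=> /andP[_ Ps] ij; have [neq adjE col] := IH i j Ps ij; split=> // -[].
Qed.

(** The first [n.+1] vertices of [s] already span an induced path with [n] edges. *)
Lemma mono_path_win h c s n :
  loopless h -> mono_path h c s -> n < size s ->
  mono_induced_copy (path_graph n) h.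
Proof.
move=> loopf Ps n_s.
have lt_s (i : 'I_n.+1) : i < size s by apply: leq_trans (ltn_ord i) n_s.
pose S : {fset nat} := [fset x in take n.+1 s]%fset.
have inS (i : 'I_n.+1) : nth 0 s i \in S.
  rewrite in_fset /= -(nth_take 0 (ltn_ord i)) mem_nth //.
  by rewrite size_takel.
pose f (i : path_graph n) : S := [` inS i]%fset.
have fP u : u \in S -> exists i : path_graph n, val (f i) = u.
  rewrite in_fset => /(nthP 0)[i].
  rewrite size_takel // => i_n <-.
  by exists (Ordinal i_n); rewrite /= nth_take.
have adjE (i j : path_graph n) :
    adj h (val (f i)) (val (f j)) = sedge i j /\
    (sedge i j -> colored h c (val (f i)) (val (f j))).
  wlog ij : i j / i <= j => [IH|].
    have [/IH //|/ltnW/IH[Eji cji]] := leqP i j.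
    by rewrite adj_sym colored_sym sedge_sym.
  rewrite leq_eqVlt in ij; case/orP: ij => [/eqP/val_inj->|ij].
    by rewrite sedge_irr loopless_adj.
  have [|nij Eij cij] := mono_path_nth (i := i) (j := j) Ps.
    by rewrite ij lt_s.
  rewrite /= /path_rel [j.+1 == i]gtn_eqF ?orbF //; last by rewrite ltnS ltnW.
  by split=> // /eqP.
have f_inj : injective f.
  suff neq (i j : 'I_n.+1) : i < j -> f i <> f j.
    by move=> i j fij; apply: val_inj; case: (ltngtP i j) => // /neq[].
  move=> ij /(congr1 val) /= fij.
  have [|/eqP] := mono_path_nth (i := i) (j := j) Ps; last by [].
  by rewrite ij lt_s.
exists S, c; split.
  exists f; split; last by move=> i j; rewrite (adjE i j).1.
  have ex u : exists i, f i == u.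
    by have [i fi] := fP _ (valP u); exists i; apply/eqP/val_inj.
  exists (fun u => xchoose (ex u)) => [i|u]; last exact/eqP/(xchooseP (ex u)).
  by apply: f_inj; apply/eqP/(xchooseP (ex (f i))).
move=> u v /fP[i <-] /fP[j <-]; rewrite (adjE i j).1; exact: (adjE i j).2.
Qed.

(** * Backward induction on the game tree *)

(** A winning tree for Builder, whose moves may depend on the number of rounds left. It may stop
    early, since further edges can spoil an induced copy. *)
Inductive forces (H : sgraph) : nat -> position -> Prop :=
| forces_now k h : mono_induced_copy H h -> forces H k h
| forces_next k h (e : edge) : legal_move h e ->
    (forall c, forces H k (rcons h (e, c))) -> forces H k.+1 h.

Lemma forces_leq H k k' h : k <= k' -> forces H k h -> forces H k' h.
Proof.
move=> kk' Fk; elim: Fk k' kk' => {k h} [k h win|k h e le _ IH] [|k'] // kk'.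
- exact: forces_now.
- exact: forces_now.
- by apply: forces_next le _ => c; apply: IH.
Qed.

Lemma forces0 H h : forces H 0 h -> mono_induced_copy H h.
Proof. by move E: 0 => k Fk; case: Fk E. Qed.

(** A strategy must be legal at every position, even where Builder has already won or cannot force a
    win. *)
Lemma legal_exists h : exists e, legal_move h e.
Proof.
by have [z /andP[z0 _]] := fresh_vertex h [:: 0]; exists (z, 0).
Qed.

(* A strategy sees the position but not the number of rounds left, so the move
   is taken from the least number of rounds in which Builder can force a win. *)
Lemma good_move H h : exists e, legal_move h e /\
  (~ mono_induced_copy H h -> forall k, forces H k.+1 h ->
   forall c, forces H k (rcons h (e, c))).
Proof.
have [e0 le0] := legal_exists h.
have [win|nwin] := pselect (mono_induced_copy H h); first by exists e0.
have [ex|nex] := pselect (exists k, `[< forces H k h >]); last first.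
  exists e0; split=> // _ k Fk; case: nex; exists k.+1; exact/asboolP.
case: (ex_minnP ex) => k0 /asboolP Fk0 min_k0.
case: Fk0 nwin min_k0 => {ex le0} [k h' win|k h' e le Fe] nwin min_k0 //.
(* Minimality gives [k.+1 <= k'.+1], so the move [e] serves every larger budget as well. *)
exists e; split=> // _ k' Fk' c; apply: forces_leq (Fe c).
by rewrite -ltnS; apply/min_k0/asboolP.
Qed.

Lemma forces_builder_wins H m : forces H m [::] -> builder_wins_within H m.
Proof.
move=> Fm; have [B BP] := choice (good_move H).
exists B; split=> [h|P]; first by case: (BP h).
suff reach k j : forces H k (play B P j) ->
    exists i, i <= k /\ mono_induced_copy H (play B P (i + j)).
  by have [i [im]] := reach m 0 Fm; rewrite addn0; exists i.
elim: k j => [|k IH] j Fk.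
  by exists 0; split=> //; apply: forces0.
have [win|nwin] := pselect (mono_induced_copy H (play B P j)).
  by exists 0.
have [|i [ik]] := IH j.+1; first exact: (BP _).2.
by rewrite addnS -addSn; exists i.+1.
Qed.

(** * Stability of paths under a new edge *)

Lemma all_apart_rcons h a b d x s : a \notin s -> b \notin s ->
  all (apart h x) s -> all (apart (rcons h (a, b, d)) x) s.
Proof.
move=> nas nbs /allP xs; apply/allP => v vs; rewrite apart_rcons xs //=.
have [/negPf-> /negPf->] : v != a /\ v != b; last by rewrite !andbF.
by split; [apply: contraNneq nas => <-|apply: contraNneq nbs => <-].
Qed.

(** Every edge between the two sequences has an end in [s2], so avoiding that one side suffices. *)
Lemma separated_rcons h a b d s1 s2 : a \notin s2 -> b \notin s2 ->
  separated h s1 s2 -> separated (rcons h (a, b, d)) s1 s2.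
Proof. by move=> nas nbs; apply: sub_all => x; apply: all_apart_rcons. Qed.

Lemma linked_rcons h a b d c x s : a \notin s -> b \notin s ->
  linked h c x s -> linked (rcons h (a, b, d)) c x s.
Proof.
case: s => //= y s; rewrite !inE !negb_or => /andP[_ nas] /andP[_ nbs].
by case/and3P=> -> cxy xs; rewrite colored_rcons cxy orbT all_apart_rcons.
Qed.

Lemma mono_path_rcons h a b d c s : a \notin s -> b \notin s ->
  mono_path h c s -> mono_path (rcons h (a, b, d)) c s.
Proof.
elim: s => //= x s IH; rewrite !inE !negb_or => /andP[_ nas] /andP[_ nbs].
by case/andP=> xs Ps; rewrite linked_rcons ?IH.
Qed.

Lemma linked_notin h c x s : linked h c x s -> x \notin s.
Proof.
case: s => //= y s /and3P[nxy _ /allP xs]; rewrite inE negb_or nxy.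
by apply/negP => /xs; rewrite /apart eqxx.
Qed.

Lemma apart_notin h x s : all (apart h x) s -> x \notin s.
Proof. by move=> /allP xs; apply/negP => /xs; rewrite /apart eqxx. Qed.

(** * Configurations and their potential *)

Definition configuration h c (P N Q : seq nat) :=
  [/\ loopless h,
      [&& mono_path h c P, mono_path h (~~ c) N & mono_path h c Q]
    & [&& separated h P N, separated h P Q & separated h N Q]].

(* An empty sequence counts as a single vertex: a fresh one can replace it. *)
Definition edges (s : seq nat) := (size s).-1.

Definition potential P N Q := 5 * (edges P + edges N) + edges Q.

Lemma nonempty_path h c s L : mono_path h c s -> separated h s L ->
  exists x s', [/\ mono_path h c (x :: s'), separated h (x :: s') L
                 & edges (x :: s') = edges s].
Proof.
case: s => [|x s] Ps sL; last by exists x, s.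
have [z zL] := fresh_vertex h L; exists z, [::]; split=> //.
by rewrite /separated allrel1l.
Qed.

Lemma configuration_nonempty h c P N Q : configuration h c P N Q ->
  exists x P' y N' t Q', configuration h c (x :: P') (y :: N') (t :: Q') /\
    potential (x :: P') (y :: N') (t :: Q') = potential P N Q.
Proof.
case=> loopf /and3P[PP PN PQ] /and3P[sPN sPQ sNQ].
have sPL : separated h P (N ++ Q) by rewrite separated_catr sPN.
have [x [P' [{}PP {}sPL eP]]] := nonempty_path PP sPL.
move: sPL; rewrite separated_catr => /andP[{}sPN {}sPQ].
(* The paths are treated in turn, so that each fresh vertex also avoids those chosen before it. *)
have sNL : separated h N ((x :: P') ++ Q).
  by rewrite separated_catr (separated_sym _ N) sPN.
have [y [N' [{}PN {}sNL eN]]] := nonempty_path PN sNL.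
move: sNL; rewrite separated_catr => /andP[{}sPN {}sNQ].
have sQL : separated h Q ((x :: P') ++ (y :: N')).
  by rewrite separated_catr !(separated_sym _ Q) sPQ.
have [t [Q' [{}PQ {}sQL eQ]]] := nonempty_path PQ sQL.
move: sQL; rewrite separated_catr => /andP[{}sPQ {}sNQ].
exists x, P', y, N', t, Q'; rewrite /potential eP eN eQ; split=> //; split=> //.
  by rewrite PP PN PQ.
rewrite (separated_sym _ (x :: P')) sPN.
by rewrite !(separated_sym _ _ (t :: Q')) sPQ sNQ.
Qed.

Lemma separated_cons2 h x s1 y s2 : separated h (x :: s1) (y :: s2) =
  [&& apart h x y, all (apart h x) s2, all (apart h y) s1 & separated h s1 s2].
Proof.
rewrite separated_consl [separated _ s1 _]separated_sym separated_consl.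
by rewrite [separated _ s2 _]separated_sym /= -andbA.
Qed.

Lemma separated_catrevl h s1 s2 s :
  separated h (catrev s1 s2) s = separated h s1 s && separated h s2 s.
Proof. by rewrite /separated /allrel catrevE all_cat all_rev. Qed.

Lemma all_behead (T : Type) (p : pred T) s : all p s -> all p (behead s).
Proof. by case: s => //= x s /andP[]. Qed.

Lemma separated_beheadr h s1 s2 :
  separated h s1 s2 -> separated h s1 (behead s2).
Proof. by apply: sub_all => x; apply: all_behead. Qed.

(* Everything that holds of the ends [x], [y], [t] of the three paths and of a
   fresh vertex [z], except for the edges between these four vertices. *)
Definition skeleton h c x (P : seq nat) y (N : seq nat) t (Q : seq nat) z :=
  [/\ [&& mono_path h c P, mono_path h (~~ c) N & mono_path h c Q],
      [&& linked h c x P, linked h (~~ c) y N & linked h c t Q],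
      [&& separated h P N, separated h P Q & separated h N Q]
    & [/\ [&& all (apart h y) P, all (apart h t) P & all (apart h z) P],
          [&& all (apart h x) N, all (apart h t) N & all (apart h z) N]
        & [&& all (apart h x) Q, all (apart h y) Q & all (apart h z) Q]]].

(** The edges that Builder plays join two of [x], [y], [t], [z], all outside the three tails, and so
    affect nothing recorded in the skeleton. *)
Lemma skeleton_rcons h a b d c x P y N t Q z :
    a \notin P ++ N ++ Q -> b \notin P ++ N ++ Q ->
    skeleton h c x P y N t Q z ->
  skeleton (rcons h (a, b, d)) c x P y N t Q z.
Proof.
rewrite !mem_cat !negb_or => /and3P[aP aN aQ] /and3P[bP bN bQ].
move=> [/and3P[? ? ?] /and3P[? ? ?] /and3P[? ? ?]].
move=> [/and3P[? ? ?] /and3P[? ? ?] /and3P[? ? ?]].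
by split; [| | |split]; apply/and3P; split;
   rewrite ?mono_path_rcons ?linked_rcons ?separated_rcons ?all_apart_rcons.
Qed.

Lemma skeleton_notin h c x P y N t Q z : skeleton h c x P y N t Q z ->
  [/\ x \notin P ++ N ++ Q, y \notin P ++ N ++ Q, t \notin P ++ N ++ Q
    & z \notin P ++ N ++ Q].
Proof.
case=> _ /and3P[xP yN tQ] _.
case=> /and3P[yP tP zP] /and3P[xN tN zN] /and3P[xQ yQ zQ].
rewrite !mem_cat !negb_or (linked_notin xP) (linked_notin yN) (linked_notin tQ).
by rewrite !(apart_notin (h := h)).
Qed.

(** When the spare is the single vertex [t], it is a path of either color, so the colors can swap
    roles. *)
Lemma skeleton_swap h c x P y N t z :
  skeleton h c x P y N t [::] z -> skeleton h (~~ c) y N x P t [::] z.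
Proof.
case=> /and3P[PP PN _] /and3P[xP yN _] /and3P[sPN _ _].
case=> /and3P[yP tP zP] /and3P[xN tN zN] _.
split; first by rewrite negbK PN PP.
- by rewrite negbK yN xP.
- by rewrite separated_sym sPN !(separated_sym _ _ [::]).
- by split; apply/and3P; split.
Qed.

(** * Outcomes of Builder's moves *)

Lemma configuration_extend h c x P y N t Q z :
    loopless h -> skeleton h c x P y N t Q z -> colored h c t z ->
    [&& t != z, apart h x y, apart h x t & apart h y t] ->
    apart h z x && apart h z y ->
  configuration h c (x :: P) (y :: N) [:: z, t & Q].
Proof.
move=> loopf [/and3P[PP PN PQ] /and3P[xP yN tQ] /and3P[sPN sPQ sNQ]].
move=> [/and3P[yP tP zP] /and3P[xN tN zN] /and3P[xQ yQ zQ]] ctz.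
case/and4P=> ntz axy axt ayt /andP[azx azy]; split=> //=.
  by rewrite xP PP yN PN tQ PQ eq_sym ntz colored_sym ctz zQ.
rewrite !separated_cons2 /= axy axt ayt xN yP xQ yQ zP zN sPN.
rewrite !(apart_sym _ _ z) azx azy !(separated_sym _ _ (t :: Q)).
by rewrite !separated_consl tP tN !(separated_sym _ Q) sPQ sNQ.
Qed.

Lemma configuration_skeleton h c x P y N t Q z :
    configuration h c (x :: P) (y :: N) (t :: Q) ->
    all (apart h z) (P ++ N ++ Q) ->
  skeleton h c x P y N t Q z /\ [&& apart h x y, apart h x t & apart h y t].
Proof.
case=> _ /= /and3P[/andP[xP PP] /andP[yN PN] /andP[tQ PQ]].
rewrite !separated_cons2 => /and3P[/and4P[-> xN yP sPN] /and4P[-> xQ tP sPQ]].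
case/and4P=> -> yQ tN sNQ; rewrite !all_cat => /and3P[zP zN zQ]; split=> //.
by split; [| | |split]; apply/and3P; split.
Qed.

(** If the last edge has color [c], the spare is absorbed into [P] and the total length of [P] and
    [N] grows by at least [size Q], a gain of at least [4 * size Q]. Otherwise [N] grows by 3 or 4
    edges, while [P] loses at most 1 or 2 respectively and [Q] at most 2, a gain of at least 8. *)
Lemma configuration_gain h c e e' x P y N t Q z :
    loopless h -> skeleton h c x P y N t Q z -> 0 < size Q ->
    [&& t != z, x != y & (if e == c then y else x) != t] ->
    [&& colored h (~~ c) t z, colored h e x y
      & colored h e' (if e == c then y else x) t] ->
    [&& apart h z x, apart h z y & apart h t (if e == c then x else y)] ->
  exists P' N' Q', configuration h c P' N' Q' /\
    potential (x :: P) (y :: N) (t :: Q) + 3 <= potential P' N' Q'.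
Proof.
move=> loopf [/and3P[PP PN PQ] /and3P[xP yN tQ] /and3P[sPN sPQ sNQ]].
move=> [/and3P[yP tP zP] /and3P[xN tN zN] /and3P[xQ yQ zQ]] Q_gt0.
have [sNP sQP sQN] : [/\ separated h N P, separated h Q P & separated h Q N].
  by rewrite !(separated_sym h Q) separated_sym.
have PtQ : mono_path h c (t :: Q) by rewrite /= tQ.
have flip d : d != c -> d = ~~ c by case: d; case: (c).
have [->|/flip->] := eqVneq e c; have [->|/flip->] := eqVneq e' c;
  move=> /and3P[ntz nxy nst] /and3P[ctz cxy cst] /and3P[azx azy ato].
(* The vertex [y] passes from [N] to [P], so its neighbor on [N] is deleted too; [z], adjacent to
   [t], is abandoned. *)
- exists (catrev (t :: Q) (y :: x :: P)), (behead N), [::]; split.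
    split=> //.
      rewrite mono_path_catrev //= ?mono_path_behead //.
      + by rewrite (eq_sym y) nxy (colored_sym _ _ y) cxy yP xP.
      + by rewrite eq_sym.
      + by rewrite colored_sym.
      + by rewrite ato tP.
      + by rewrite separated_sym separated_consl xQ.
    rewrite !(separated_sym _ _ [::]) !andbT separated_catrevl !separated_consl.
    by rewrite (linked_behead yN) !all_behead ?separated_beheadr.
  by rewrite /potential /edges catrevE size_cat size_rev size_behead /=; clear -Q_gt0; lia.
(* Here [x], adjacent to [y], is deleted, as is the neighbor of [t] on [Q]. *)
- exists P, [:: z, t, y & N], (behead Q); split.
    split=> //=.
      rewrite PP PN yN mono_path_behead // eq_sym ntz colored_sym ctz azy zN.
      by rewrite eq_sym nst colored_sym cst tN.
    rewrite separated_sym !separated_consl zP tP yP sNP !separated_beheadr //.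
    by rewrite (linked_behead tQ) !all_behead.
  by rewrite /potential /edges size_behead /=; clear -Q_gt0; lia.
(* Now [y], adjacent to [x], and [z], adjacent to [t], are deleted. *)
- exists (catrev (t :: Q) (x :: P)), N, [::]; split.
    split=> //.
      rewrite mono_path_catrev //= ?PN //.
      + by rewrite xP.
      + by rewrite eq_sym.
      + by rewrite colored_sym.
    rewrite !(separated_sym _ _ [::]) !andbT separated_catrevl !separated_consl.
    by rewrite tN sQN xN.
  by rewrite /potential /edges catrevE size_cat size_rev /=; clear -Q_gt0; lia.
(* Both [x] and [t] pass to [N], so their neighbors on [P] and [Q] are deleted. *)
- exists (behead P), [:: z, t, x, y & N], (behead Q); split.
    split=> //=.
      rewrite !mono_path_behead // PN yN eq_sym ntz colored_sym ctz azx azy zN.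
      by rewrite eq_sym nst colored_sym cst ato tN nxy cxy xN.
    rewrite separated_sym !separated_consl.
    rewrite (linked_behead xP) (linked_behead tQ) !all_behead //.
    rewrite !separated_beheadr //.
    by rewrite separated_sym separated_beheadr // separated_sym.
  by rewrite /potential /edges !size_behead /=; clear -Q_gt0; lia.
Qed.

(** Strong induction on the rounds left, since a step takes one or three rounds and the potential
    pays for them. *)
Lemma forces_path n m h c P N Q : 0 < n -> configuration h c P N Q ->
  28 * n - 27 <= potential P N Q + m -> forces (path_graph n) m h.
Proof.
move=> n_gt0; elim/ltn_ind: m h c P N Q => m IH h c P0 N0 Q0.
case/configuration_nonempty=> x [P [y [N [t [Q [conf <-]]]]]] le_m.
have [loopf /and3P[PP PN PQ] _] := conf.
have [?|le_P] := ltnP n (size (x :: P)).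
  exact/forces_now/(mono_path_win loopf PP).
have [?|le_N] := ltnP n (size (y :: N)).
  exact/forces_now/(mono_path_win loopf PN).
have [?|le_Q] := ltnP n (size (t :: Q)).
  exact/forces_now/(mono_path_win loopf PQ).
have [z /= /and4P[azx azy azt zs]] := fresh_vertex h [:: x, y, t & P ++ N ++ Q].
have [sk /and3P[axy axt ayt]] := configuration_skeleton conf zs.
have [xs ys ts {}zs] := skeleton_notin sk.
have [nxy nxt nyt] : [/\ x != y, x != t & y != t].
  by move: axy axt ayt; rewrite /apart; do 3!case/andP=> -> _.
have [nzx nzy nzt] : [/\ z != x, z != y & z != t].
  by move: azx azy azt; rewrite /apart; do 3!case/andP=> -> _.
have neqs := (negbTE nxy, negbTE nxt, negbTE nyt,
  negbTE nzx, negbTE nzy, negbTE nzt, eq_sym y x, eq_sym t x, eq_sym t y,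
  eq_sym x z, eq_sym y z, eq_sym t z).
move: le_m le_P le_N le_Q; rewrite /potential /edges /= => le_m le_P le_N le_Q.
(* Each path has at most [n - 1] edges, so the potential is at most [11 * (n - 1)], below
   [28 * n - 27]: a round is left. *)
case: m IH le_m => [|m] IH le_m; first by clear -n_gt0 le_m le_P le_N le_Q; lia.
apply: (forces_next (e := (t, z))) => [|d].
  by rewrite /legal_move /= -/(apart h t z) apart_sym.
set h1 := rcons h _.
have loopf1 : loopless h1 by rewrite /h1 /loopless all_rcons /= !neqs.
have sk1 : skeleton h1 c x P y N t Q z by apply: skeleton_rcons.
have ap1 u v : apart h1 u v =
    apart h u v && ~~ ((u == t) && (v == z) || (u == z) && (v == t)).
  exact: apart_rcons.
have ctz : colored h1 d t z by rewrite colored_rcons !eqxx.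
have [Ed|nd] := eqVneq d c.
  apply: (IH _ _ _ c (x :: P) (y :: N) [:: z, t & Q]) => //; last first.
    by rewrite /potential /edges /=; clear -le_m; lia.
  rewrite -Ed in sk1 *; apply: configuration_extend => //.
    by rewrite !ap1 axy axt ayt !neqs.
  by rewrite !ap1 azx azy !neqs !eqxx.
have {nd}Ed : d = ~~ c by move: nd; clear; case: d; case: c.
case: (posnP (size Q)) => [/size0nil Q0'|Q_gt0].
  rewrite Q0' /= in sk1 le_m; rewrite Ed in ctz.
  apply: (IH _ _ _ (~~ c) (y :: N) (x :: P) [:: z; t]) => //; last first.
    by rewrite /potential /edges /=; clear -le_m; lia.
  apply: (configuration_extend loopf1 (skeleton_swap sk1) ctz).
    by rewrite !ap1 !neqs /= ayt axt apart_sym axy.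
  by rewrite !ap1 azx azy !neqs !eqxx.
(* A nonempty [Q] forces [n >= 2], and the same bound then leaves the two further rounds. *)
case: m IH le_m => [|[|m]] IH le_m.
- by clear -n_gt0 le_m le_P le_N le_Q Q_gt0; lia.
- by clear -n_gt0 le_m le_P le_N le_Q Q_gt0; lia.
apply: (forces_next (e := (x, y))) => [|e].
  by rewrite /legal_move /= -/(apart h1 x y) ap1 axy !neqs.
set h2 := rcons h1 _.
have ap2 u v : apart h2 u v =
    apart h1 u v && ~~ ((u == x) && (v == y) || (u == y) && (v == x)).
  exact: apart_rcons.
(* The edge [xy] lengthens the path of its color at either end, so [s] is the end whose own path has
   the opposite color. *)
pose s := if e == c then y else x.
have ns : s \notin P ++ N ++ Q by rewrite /s; case: (e == c).
have nst : s != t by rewrite /s; case: (e == c).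
apply: (forces_next (e := (s, t))) => [|e'].
  rewrite /legal_move /= -/(apart h2 s t) ap2 ap1 /s.
  by case: (e == c); rewrite ?axt ?ayt !neqs !eqxx.
set h3 := rcons h2 _.
have ap3 u v : apart h3 u v =
    apart h2 u v && ~~ ((u == s) && (v == t) || (u == t) && (v == s)).
  exact: apart_rcons.
have [|||||P' [N' [Q' [conf' gain]]]] :=
    @configuration_gain h3 c e e' x P y N t Q z _ _ Q_gt0.
- by rewrite /h3 /h2 /loopless 2!all_rcons /= nst nxy; apply: loopf1.
- by do 2!apply: skeleton_rcons => //.
- by rewrite nst nxy !neqs.
- rewrite -Ed -/s; apply/and3P; split.
  + by rewrite /h3 /h2 2!colored_rcons ctz !orbT.
  + by rewrite /h3 /h2 2!colored_rcons !eqxx orbT.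
  + by rewrite /h3 colored_rcons !eqxx.
- rewrite !ap3 !ap2 !ap1 /s.
  case: (e == c); rewrite !neqs !eqxx /= ?andbF ?andbT //=.
  + by rewrite azx azy apart_sym axt.
  + by rewrite azx azy apart_sym ayt.
by apply: IH conf' _; move: gain; rewrite /potential /edges /=; clear -le_m; lia.
Qed.

Theorem theorem2 (n : nat) (n_gt0 : 0 < n) :
  le_onat (induced_online_ramsey (path_graph n)) (Some (28 * n - 27)).
Proof.
have wins : builder_wins_within (path_graph n) (28 * n - 27).
  apply: forces_builder_wins.
  (* The game starts at potential 0, with three single vertices encoded as empty sequences. *)
  exact: (@forces_path n _ [::] true [::] [::] [::] n_gt0).
rewrite /induced_online_ramsey; case: pselect => [ex_m|[]] /=.
  by case: ex_minnP => m _; apply; apply/asboolP.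
by exists (28 * n - 27); apply/asboolP.
Qed.
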